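(* In the setting and with the choices described in the context, let $\widetilde{N}_1=\mathfrak{s}(G,H,\mu)\cdot m\oplus X_m\oplus N_1$ be a symplectic slice at $m$ relative to the $H$-action, where $X_m=\mathfrak b\cdot m\oplus Y_m$ with $Y_m\subset N_0$ isomorphic to $\mathfrak b^*$. With respect to this splitting, the momentum map $\Phi_{\widetilde N_1}:\widetilde N_1\to\mathfrak h_m^*$ associated to the linear Hamiltonian $H_m$-action on $\widetilde N_1$ decomposes as $$\langle\Phi_{\widetilde N_1}(\widetilde\nu),\eta\rangle=\tfrac12\langle(\mathrm{ad}^*_x)^2\mu,\eta\rangle+\langle-\mathrm{ad}^*_bf(w),\eta\rangle+\tfrac12\,\omega_{N_1}\left(\eta_{N_1}(\nu),\nu\right)$$ for every $\eta\in\mathfrak h_m$, where $\widetilde\nu=x_M(m)+(b_M(m)+w)+\nu\in\widetilde N_1$ with $x\in\mathfrak s(G,H,\mu)$, $b\in\mathfrak b$, $w\in Y_m$ and $\nu\in N_1$.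
   Context: Setting. $(M,\omega)$ is a symplectic manifold with a smooth proper action of a Lie group $G$ preserving $\omega$; for $x\in\mathfrak g$, $x_M$ denotes the vector field $x_M(p)=\frac{d}{dt}|_{t=0}\exp(tx)\cdot p$. There is a momentum map $\Phi_G:M\to\mathfrak g^*$, $\iota_{x_M}\omega=d\langle\Phi_G(\cdot),x\rangle$ for all $x\in\mathfrak g$, equivariant for the coadjoint action of $G$ on $\mathfrak g^*$ given by $\langle \mathrm{Ad}^*_{g^{-1}}\lambda,x\rangle=\langle\lambda,\mathrm{Ad}_{g^{-1}}x\rangle$. Write $\langle\mathrm{ad}^*_x\lambda,y\rangle=\langle\lambda,[x,y]\rangle$. $H\subset G$ is a Lie subgroup with Lie algebra $\mathfrak h$; the induced momentum map is $\Phi_H:M\to\mathfrak h^*$, $\Phi_H(p)=\Phi_G(p)|_{\mathfrak h}$. Fix $m\in M$, $\mu=\Phi_G(m)$, $\alpha=\Phi_H(m)=\mu|_{\mathfrak h}$. $G_m,H_m$ are the stabilizers of $m$, with Lie algebras $\mathfrak g_m,\mathfrak h_m$; $\mathfrak g_\mu=\{x\in\mathfrak g:\mathrm{ad}^*_x\mu=0\}$, $\mathfrak h_\mu=\mathfrak h\cap\mathfrak g_\mu$, $\mathfrak h_\alpha=\{x\in\mathfrak h:\mathrm{ad}^*_x\alpha=0\text{ in }\mathfrak h^*\}$. For a subspace $\mathfrak k\subset\mathfrak g$, $\mathfrak k\cdot m=\{x_M(m):x\in\mathfrak k\}\subset T_mM$. Standing assumption (A): $G_m$ acts on $H$ by conjugation,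 i.e. $kHk^{-1}=H$ for all $k\in G_m$. Choices. $\mathfrak h^{\perp_\mu}:=\{x\in\mathfrak g: x_M(m)\in(\mathfrak h\cdot m)^{\omega(m)}\}$ ($^{\omega(m)}$ denotes the symplectic orthogonal in $T_mM$); it contains $\mathfrak g_\mu+\mathfrak h_\alpha$. Choose $G_m$-invariant subspaces as follows ($G_m$ is compact and acts by the adjoint action): $\mathfrak p$ a complement of $\mathfrak h_m$ in $\mathfrak h_\mu$; $\mathfrak b$ a complement of $\mathfrak g_m+\mathfrak h_\mu$ in $\mathfrak g_\mu$; $\mathfrak a$ a complement of $\mathfrak h_\mu$ in $\mathfrak h_\alpha$ (so $\mathfrak g_\mu+\mathfrak h_\alpha=\mathfrak g_\mu\oplus\mathfrak a$); $\mathfrak s(G,H,\mu)$ a complement of $\mathfrak g_\mu+\mathfrak h_\alpha$ in $\mathfrak h^{\perp_\mu}$; $\mathfrak q=\mathfrak a\oplus\mathfrak s(G,H,\mu)$; $\widetilde{\mathfrak n}$ a complement of $\mathfrak h_\alpha$ in $\mathfrak h$; $(\mathfrak h^{\perp_\mu})^{\perp_{\mathfrak g}}$ a complement of $\mathfrak h^{\perp_\mu}$ in $\mathfrak g$, chosen with $\widetilde{\mathfrak n}\subset(\mathfrak h^{\perp_\mu})^{\perp_{\mathfrak g}}$. Set $\mathfrak m=\mathfrak p\oplus\mathfrak b$ and $\mathfrak n=\mathfrak q\oplus(\mathfrak h^{\perp_\mu})^{\perp_{\mathfrak g}}$, so that $\mathfrak g_\mu=\mathfrak g_m\oplus\mathfrak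 m$ and $\mathfrak g=\mathfrak g_m\oplus\mathfrak m\oplus\mathfrak n$. Witt–Artin decomposition relative to $G$: $T_mM=T_0\oplus T_1\oplus N_0\oplus N_1$ with $T_0=\mathfrak g_\mu\cdot m$; $T_1=\mathfrak n\cdot m$ (a symplectic subspace); $N_1$ a $G_m$-invariant complement to $T_0$ in $\ker(D\Phi_G(m))$ (a symplectic slice for $G$, with form $\omega_{N_1}=\omega(m)|_{N_1}$); $N_0$ a $G_m$-invariant Lagrangian complement to $T_0$ in $(T_1\oplus N_1)^{\omega(m)}$. The subspaces $T_1$, $N_1$ and $T_0\oplus N_0$ are mutually symplectically orthogonal. The map $f:N_0\to\mathfrak m^*$, $\langle f(w),y\rangle=\omega(m)(y_M(m),w)$ for $w\in N_0$, $y\in\mathfrak m$, is an isomorphism. Elements of $\mathfrak m^*$ are regarded as elements of $\mathfrak g^*$ vanishing on $\mathfrak g_m\oplus\mathfrak n$, so that $\langle-\mathrm{ad}^*_bf(w),\eta\rangle=-\langle f(w),[b,\eta]\rangle$. A symplectic slice at $m$ relative to the $H$-action is an $H_m$-invariant complement $\widetilde N_1$ to $\mathfrak h_\alpha\cdot m$ in $\ker(D\Phi_H(m))$, endowed with the symplectic form $\omega_{\widetilde N_1}=\omega(m)|_{\widetilde N_1}$. The linear action of $H_m$ on it has momentum map given by $\langle\Phi_{\widetilde N_1}(\widetilde\nu),\eta\rangle=\frac12\omega(m)(\eta_{\widetilde N_1}(\widetilde\nu),\widetilde\nu)$ for $\eta\in\mathfrak h_m$, where $\eta_{\widetilde N_1}(\widetilde\nu)=\frac{d}{dt}|_{t=0}\exp(t\eta)\cdot\widetilde\nu$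 is the infinitesimal generator of the linear action; $\eta_{N_1}(\nu)$ is defined likewise on $N_1$. *)

(* Defs.v *)
From HB Require Import structures.
From mathcomp Require Import all_boot all_order all_algebra.
From mathcomp Require Import all_classical all_reals all_analysis.

Set Implicit Arguments.
Unset Strict Implicit.
Unset Printing Implicit Defensive.

Import Order.TTheory GRing.Theory Num.Theory.
Import numFieldNormedType.Exports.
Local Open Scope classical_set_scope.
Local Open Scope ring_scope.

Section Subspaces.
Context {R : pzRingType} {V : lmodType R}.
Implicit Types A B C : set V.

Definition is_subspace A : Prop :=
  A 0 /\ forall (a : R) u v, A u -> A v -> A (a *: u + v).

Definition sumset A B : set V := [set u + v | u in A & v in B].

(* C is the internal direct sum of A and B; equivalently, B is a complement
   of A in C. *)
Definition direct_sum C A B : Prop :=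
  [/\ is_subspace A, is_subspace B, A `&` B = [set 0] & C = sumset A B].

Definition invariant_under {T : Type} (K : set T) (rho : T -> V -> V) A : Prop :=
  forall g v, K g -> A v -> A (rho g v).

End Subspaces.

(* In finite dimension, C^(k+1) means: differentiable, with all directional
   derivatives of class C^k. *)
Fixpoint Ck_on {R : realType} {V W : normedModType R} (k : nat) (U : set V)
    (f : V -> W) : Prop :=
  if k is k'.+1 then
    (forall x, U x -> differentiable f x) /\ (forall v, Ck_on k' U ('D_v f))
  else forall x, U x -> {for x, continuous f}.

Definition smooth_on {R : realType} {V W : normedModType R} (U : set V)
    (f : V -> W) : Prop :=
  forall k, Ck_on k U f.

Record chart (R : realType) (n : nat) (M : topologicalType) := Chart {
  cdom : set M;
  cmap : M -> 'rV[R]_n;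
  cinv : 'rV[R]_n -> M;
  cdom_open : open cdom;
  cimg_open : open (cmap @` cdom);
  cmapK : {in cdom, cancel cmap cinv};
  cmap_continuous : {in cdom, continuous cmap};
  cinv_continuous : {in cmap @` cdom, continuous cinv} }.

Definition cimg {R : realType} {n : nat} {M : topologicalType}
  (c : chart R n M) : set 'rV[R]_n := cmap c @` cdom c.

(* The smooth structure is given by an atlas consisting of one preferred chart
   around each point. *)
HB.mixin Record isManifold (R : realType) (n : nat) M of Topological M := {
  chart_at : M -> chart R n M;
  mfd_hausdorff : hausdorff_space M;
  mfd_second_countable : @second_countable M;
  mem_chart_at : forall p, cdom (chart_at p) p;
  chart_transition : forall p q,
    smooth_on (cmap (chart_at p) @` (cdom (chart_at p) `&` cdom (chart_at q)))
      (cmap (chart_at q) \o cinv (chart_at p)) }.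

#[short(type="manifoldType")]
HB.structure Definition Manifold (R : realType) (n : nat) :=
  { M of Topological M & isManifold R n M }.

(* The tangent space at p is identified with 'rV[R]_n through the preferred
   chart at p.  All derivatives below are expressed in the preferred charts at
   the point and at its image. *)

Definition chart_coord {R : realType} {n : nat} {M : manifoldType R n} (p : M) :
  M -> 'rV[R]_n := cmap (chart_at p).

Definition param {R : realType} {n : nat} {M : manifoldType R n} (p : M) :
  'rV[R]_n -> M := cinv (chart_at p).

Section Smoothness.
Context {R : realType}.

Definition smooth_into {n} {M : manifoldType R n} {V : normedModType R}
    (U : set V) (h : V -> M) : Prop :=
  (forall u, U u -> {for u, continuous h}) /\
  (forall q : M,
     smooth_on (U `&` h @^-1` cdom (chart_at q)) (chart_coord q \o h)).

Definition smooth_map {m n} {M : manifoldType R m} {N : manifoldType R n}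
    (f : M -> N) : Prop :=
  forall p : M, smooth_into (cimg (chart_at p)) (f \o param p).

Definition smooth_map2 {m1 m2 n} {M1 : manifoldType R m1}
    {M2 : manifoldType R m2} {N : manifoldType R n}
    (f : M1 -> M2 -> N) : Prop :=
  forall (p1 : M1) (p2 : M2),
    smooth_into (cimg (chart_at p1) `*` cimg (chart_at p2))
      (fun u : 'rV[R]_m1 * 'rV[R]_m2 => f (param p1 u.1) (param p2 u.2)).

Definition smooth_fun {m} {M : manifoldType R m} {W : normedModType R}
    (f : M -> W) : Prop :=
  forall p : M, smooth_on (cimg (chart_at p)) (f \o param p).

Definition smooth_curve {n} {M : manifoldType R n} (c : R -> M) : Prop :=
  smooth_into [set: R^o] c.

Definition dfun {m} {M : manifoldType R m} {W : normedModType R}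
    (f : M -> W) (p : M) : 'rV[R]_m -> W :=
  'd (f \o param p) (chart_coord p p).

(* Tangent map at p, from the tangent space at p to the one at f p. *)
Definition tmap {m n} {M : manifoldType R m} {N : manifoldType R n}
    (f : M -> N) (p : M) : 'rV[R]_m -> 'rV[R]_n :=
  dfun (chart_coord (f p) \o f) p.

Definition velocity {n} {M : manifoldType R n} (c : R -> M) (t : R) :
    'rV[R]_n :=
  derive1 (chart_coord (c t) \o c) t.

End Smoothness.

HB.mixin Record Manifold_isLieGroup (R : realType) (n : nat) G
    of Manifold R n G & Group G := {
  smooth_mulg : smooth_map2 (fun g h : G => (g * h)%g);
  smooth_invg : smooth_map (fun g : G => g^-1%g) }.

#[short(type="lieGroupType")]
HB.structure Definition LieGroup (R : realType) (n : nat) :=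
  { G of Manifold R n G & Group G & Manifold_isLieGroup R n G }.

Section LieGroups.
Context {R : realType} {d : nat} {G : lieGroupType R d}.

(* The Lie algebra of G is the tangent space 'rV[R]_d at 1.  Note that
   g * 1 * g^-1 = 1, so Ad g takes its values in that same tangent space. *)
Definition Ad (g : G) : 'rV[R]_d -> 'rV[R]_d :=
  tmap (fun a : G => (g * a * g^-1)%g) 1%g.

(* The bracket is the differential of the adjoint representation at 1. *)
Definition lie_bracket (x y : 'rV[R]_d) : 'rV[R]_d :=
  dfun (fun g : G => Ad g y) 1%g x.

(* The exponential map is characterized by its one-parameter subgroups. *)
Definition is_exponential (lexp : 'rV[R]_d -> G) : Prop :=
  forall x : 'rV[R]_d,
  [/\ smooth_curve (fun t : R => lexp (t *: x)),
      (forall s t : R, lexp ((s + t) *: x) = (lexp (s *: x) * lexp (t *: x))%g)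
    & velocity (fun t : R => lexp (t *: x)) 0 = x].

(* Lie algebra of K, for K a closed subgroup. *)
Definition lie_of (lexp : 'rV[R]_d -> G) (K : set G) : set 'rV[R]_d :=
  [set x | forall t : R, K (lexp (t *: x))].

End LieGroups.

(* The dual of 'rV[R]_d is 'cV[R]_d. *)
Definition pairing {R : realType} {d : nat} (lam : 'cV[R]_d) (x : 'rV[R]_d) :
  R := (x *m lam) 0 0.

(* The element of the dual corresponding to a linear functional F. *)
Definition functional {R : realType} {d : nat} (F : 'rV[R]_d -> R) :
  'cV[R]_d := \col_i F (delta_mx 0 i).

(* <ad^*_x lam, y> = <lam, [x, y]> *)
Definition coad {R : realType} {d : nat} (G : lieGroupType R d)
    (x : 'rV[R]_d) (lam : 'cV[R]_d) : 'cV[R]_d :=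
  functional (fun y => pairing lam (lie_bracket (G := G) x y)).

(* Immersed Lie subgroups: iota is the inclusion of H in G. *)
Definition is_lie_subgroup {R : realType} {e d : nat}
    {H : lieGroupType R e} {G : lieGroupType R d} (iota : H -> G) : Prop :=
  [/\ {morph iota : h k / (h * k)%g >-> (h * k)%g}, injective iota,
      smooth_map iota & forall h, injective (tmap iota h)].

Section LieSubgroups.
Context {R : realType} {e d : nat} {H : lieGroupType R e}
  {G : lieGroupType R d}.

Definition lie_incl (iota : H -> G) : 'rV[R]_e -> 'rV[R]_d := tmap iota 1%g.

Definition dual_restr (iota : H -> G) (lam : 'cV[R]_d) : 'cV[R]_e :=
  functional (fun y => pairing lam (lie_incl iota y)).

End LieSubgroups.

Section Symplectic.
Context {R : realType} {n : nat} {M : manifoldType R n}.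
Implicit Types (omega : M -> 'rV[R]_n -> 'rV[R]_n -> R).

(* Expression in the chart at p of the 2-form omega. *)
Definition form_in_chart omega (p : M) (u v w : 'rV[R]_n) : R :=
  let q := param p u in
  omega q ('d (chart_coord q \o param p) u v) ('d (chart_coord q \o param p) u w).

Record is_symplectic_form omega : Prop := IsSymplecticForm {
  symp_linear : forall p u, scalar (omega p u);
  symp_skew : forall p u v, omega p v u = - omega p u v;
  symp_nondegenerate : forall p u, (forall v, omega p u v = 0) -> u = 0;
  symp_smooth : forall p v w,
    smooth_on (cimg (chart_at p))
      (fun u => form_in_chart omega p u v w : R^o);
  (* d omega = 0 *)
  symp_closed : forall p u v1 v2 v3, cimg (chart_at p) u ->
    'D_v1 (fun u' => form_in_chart omega p u' v2 v3 : R^o) u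
    + 'D_v2 (fun u' => form_in_chart omega p u' v3 v1 : R^o) u
    + 'D_v3 (fun u' => form_in_chart omega p u' v1 v2 : R^o) u = 0 }.

Definition symp_orth omega (p : M) (A : set 'rV[R]_n) : set 'rV[R]_n :=
  [set v | forall u, A u -> omega p u v = 0].

Definition lagrangian_in omega (p : M) (W L : set 'rV[R]_n) : Prop :=
  is_subspace L /\ L = symp_orth omega p L `&` W.

End Symplectic.

Section Actions.
Context {R : realType} {d n : nat} {G : lieGroupType R d}
  {M : manifoldType R n}.
Implicit Types (act : G -> M -> M) (lexp : 'rV[R]_d -> G).

Record is_smooth_action act : Prop := IsSmoothAction {
  act_one : forall p, act 1%g p = p;
  act_mul : forall g h p, act (g * h)%g p = act g (act h p);
  act_smooth : smooth_map2 act }.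

Definition is_proper_action act : Prop :=
  forall K : set (M * M), compact K ->
    compact [set gp : G * M | K (act gp.1 gp.2, gp.2)].

Definition stab act (m : M) : set G := [set g | act g m = m].

Definition infgen act lexp (x : 'rV[R]_d) (p : M) : 'rV[R]_n :=
  velocity (fun t : R => act (lexp (t *: x)) p) 0.

(* k . m, for a subspace k of the Lie algebra *)
Definition orbit_dir act lexp (m : M) (k : set 'rV[R]_d) : set 'rV[R]_n :=
  [set infgen act lexp x m | x in k].

(* Linear action of the stabilizer of m on the tangent space at m. *)
Definition isotropy act (m : M) (g : G) : 'rV[R]_n -> 'rV[R]_n :=
  tmap (act g) m.

Definition isotropy_gen act lexp (m : M) (eta : 'rV[R]_d) (v : 'rV[R]_n) :
    'rV[R]_n :=
  derive1 (fun t : R => isotropy act m (lexp (t *: eta)) v) 0.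

Definition preserves_form act (omega : M -> 'rV[R]_n -> 'rV[R]_n -> R) :
    Prop :=
  forall g p u v,
    omega (act g p) (tmap (act g) p u) (tmap (act g) p v) = omega p u v.

Record is_momentum_map act lexp (omega : M -> 'rV[R]_n -> 'rV[R]_n -> R)
    (Phi : M -> 'cV[R]_d) : Prop := IsMomentumMap {
  momentum_smooth : smooth_fun Phi;
  momentum_eq : forall x p v,
    omega p (infgen act lexp x p) v
    = dfun (fun q => pairing (Phi q) x : R^o) p v;
  momentum_equivariant : forall g p x,
    pairing (Phi (act g p)) x = pairing (Phi p) (Ad g^-1%g x) }.

(* Momentum map of the linear Hamiltonian action of a subgroup of the
   stabilizer of m on a symplectic subspace of the tangent space at m. *)
Definition linear_momentum act lexp
    (omega : M -> 'rV[R]_n -> 'rV[R]_n -> R) (m : M)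
    (v : 'rV[R]_n) (eta : 'rV[R]_d) : R :=
  2%:R^-1 * omega m (isotropy_gen act lexp m eta v) v.

End Actions.

(* Y is linearly isomorphic to the dual of b; an element of the dual of b is
   represented by any of its extensions to the ambient space. *)
Definition iso_to_dual {R : realType} {n d : nat} (Y : set 'rV[R]_n)
    (b : set 'rV[R]_d) : Prop :=
  exists psi : 'rV[R]_n -> 'cV[R]_d,
  [/\ linear psi,
      (forall w, Y w -> (forall y, b y -> pairing (psi w) y = 0) -> w = 0)
    & forall lam : 'cV[R]_d, exists2 w, Y w &
        forall y, b y -> pairing (psi w) y = pairing lam y].

(* Main.v *)
(* Write g.m for the action, D for the generator of the isotropy action of
   exp(t eta) on T_m M, and L for the differential at 1 of the orbit map, so that
   L x = x_M(m).  From rho_g L = L Ad_g on the stabilizer one gets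
   D (L x) = L [eta, x]; invariance of omega gives omega(D u, v) = omega(D v, u);
   equivariance of the momentum map gives omega(L x, L y) = <mu, [x, y]>.
   Expanding omega(D v, v) by symmetry on v = L x + L b + w + nu, all cross terms
   vanish except omega(D (L b), w): L b is orthogonal to the orbit because b fixes
   mu, nu is orthogonal to the orbit because it lies in ker dPhi, and N0 is
   isotropic, invariant and orthogonal to T1 and N1.  Invariance of a subspace
   enters through relations omega(rho_t u, v) = 0, differentiated at t = 0. *)
Require Import Defs.
From HB Require Import structures.
From mathcomp Require Import all_boot all_order all_algebra.
From mathcomp Require Import all_classical all_reals all_analysis ring.
Set Implicit Arguments.
Unset Strict Implicit.
Unset Printing Implicit Defensive.

Import Order.TTheory GRing.Theory Num.Theory.
Import numFieldNormedType.Exports.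
Local Open Scope classical_set_scope.
Local Open Scope ring_scope.

Section Differentials.
Context {R : realType}.
Implicit Types V W : normedModType R.

Lemma near_eq_is_diff V W (f g df : V -> W) (x : V) :
  {near x, f =1 g} -> is_diff x f df -> is_diff x g df.
Proof.
move=> fg [dfx <-].
have gx : g \o shift x = cst (g x) + 'd f x +o_ 0 id.
  have /eqaddoP fx := diff_locally dfx.
  apply/eqaddoP => e e0; have := fx e e0.
  have fg0 : \forall h \near 0, f (h + x) = g (h + x).
    by have /nbhs0P := fg; apply: filterS => h; rewrite addrC.
  apply: filter_app; near=> h.
  change (`|f (h + x) - (f x + 'd f x h)| <= e * `|h| ->
    `|g (h + x) - (g x + 'd f x h)| <= e * `|h|).
  by rewrite -(nbhs_singleton fg) -(near fg0 h).
have dE : 'd g x = 'd f x :> (V -> W).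
  by apply: diff_unique => //; exact: diff_continuous.
by split=> //; apply/diff_locallyP; rewrite dE; split=> //; exact: diff_continuous.
Unshelve. all: by end_near. Qed.

Lemma is_diff_derive1 W (f df : R -> W) (t : R) :
  is_diff t f df -> derive1 f t = df 1.
Proof. by move=> [dft <-]; rewrite derive1E'. Qed.

Lemma linear_mx_continuous m n W (f : {linear 'M[R]_(m, n) -> W}) :
  continuous f.
Proof.
have -> : (f : _ -> _) = \sum_i \sum_j
    (fun A : 'M[R]_(m, n) => A i j *: f (delta_mx i j)).
  rewrite funeqE => A; rewrite fct_sumE {1}(matrix_sum_delta A) linear_sum.
  apply: eq_bigr => i _; rewrite fct_sumE linear_sum.
  by apply: eq_bigr => j _; rewrite linearZ.
move=> A; apply: differentiable_continuous.
apply: differentiable_sum => i; apply: differentiable_sum => j.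
by apply: differentiableZl; exact: differentiable_coord.
Qed.

Lemma is_diff_linear_mx m n V W (f : {linear 'M[R]_(m, n) -> W})
    (g dg : V -> 'M[R]_(m, n)) (x : V) :
  is_diff x g dg -> is_diff x (f \o g) (f \o dg).
Proof.
move=> dgx; apply: is_diff_comp.
have cf := @linear_mx_continuous m n W f.
apply: DiffDef; first exact: linear_differentiable.
by rewrite diff_lin.
Qed.

Lemma is_diff_linear_comb V W (a : R) (f g df dg : V -> W)
    (x : V) :
  is_diff x f df -> is_diff x g dg ->
  is_diff x (fun u => a *: f u + g u) (fun u => a *: df u + dg u).
Proof.
move=> [dfx <-] [dgx <-]; have daf := differentiableZ a dfx.
split; first exact: differentiableD daf dgx.
apply: etrans (diffD daf dgx) _.
rewrite funeqE => u; apply: (congr2 +%R) => //.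
exact: (congr1 (fun h => h u) (diffZ a dfx)).
Qed.

Lemma derive1_scalar_comp n (f : 'rV[R]_n -> R) (c : R -> 'rV[R]_n) (t : R) :
  scalar f -> differentiable c t -> derive1 (f \o c) t = f (derive1 c t).
Proof.
move=> lf /differentiableP dc.
pose fM := GRing.isLinear.Build R 'rV[R]_n R^o _ (f : 'rV[R]_n -> R^o) lf.
pose fL : {linear 'rV[R]_n -> R^o} := HB.pack (f : 'rV[R]_n -> R^o) fM.
have := is_diff_derive1 (is_diff_linear_mx fL dc).
by rewrite /= (is_diff_derive1 dc).
Qed.

Lemma derive1_compN W (c : R -> W) :
  differentiable c 0 -> derive1 (fun t => c (- t)) 0 = - derive1 c 0.
Proof.
move=> dc; have dc' : differentiable c (- 0) by rewrite oppr0.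
have [dN dNE] : is_diff (0 : R) (fun t => - t) (fun t => - t) by exact: is_diffN.
have e := diff_comp dN dc'.
rewrite (derive1E' dc) -linearN.
apply: etrans (derive1E' (differentiable_comp dN dc')) _.
by apply: etrans (congr1 (fun h => h 1) e) _; rewrite /= dNE oppr0.
Qed.

Lemma differentiable_scale V W (f : V -> R) (g : V -> W) (x : V) :
  differentiable f x -> differentiable g x ->
  differentiable (fun y => f y *: g y) x.
Proof.
move=> df dg.
have sb : bilinear_for (GRing.Scale.Law.clone _ _ *:%R _)
    (GRing.Scale.Law.clone _ _ *:%R _) (fun (a : R) (w : W) => a *: w).
  split=> [u'|u] a b c /=; first by rewrite scalerDl scalerA.
  by rewrite scalerDr !scalerA mulrC.
pose sM := bilinear_isBilinear.Build R R W W _ _ _ sb.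
pose sL : {bilinear R -> W -> W} := HB.pack (fun (a : R) (w : W) => a *: w) sM.
apply: (@differentiable_comp _ _ _ _ (fun y => (f y, g y))
  (fun q : R * W => sL q.1 q.2)); first exact: differentiable_pair.
by apply: differentiable_bilin => q; exact: scale_continuous.
Qed.

Lemma differentiable_diff_apply k V V' W (F : V -> W) (j : {linear 'rV[R]_k -> V})
    (p : V' -> V) (w : V' -> 'rV[R]_k) (x : V') :
  (\forall y \near x, differentiable F (p y)) ->
  (forall v, differentiable ('D_v F) (p x)) ->
  differentiable p x -> differentiable w x ->
  differentiable (fun y => 'd F (p y) (j (w y))) x.
Proof.
move=> dF ddF dp dw.
(* Expanding w y on the canonical basis leaves only fixed directions. *)
pose g := \sum_i (fun y => (w y 0 i) *: 'D_(j (delta_mx 0 i)) F (p y)).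
suff dg : differentiable g x.
  have dw' : is_diff x (fun y => 'd F (p y) (j (w y))) ('d g x).
    apply: (@near_eq_is_diff _ _ g); last exact: differentiableP.
    near=> y; have dFy : differentiable F (p y) by near: y.
    rewrite /g fct_sumE [in RHS](row_sum_delta (w y)) !linear_sum.
    by apply: eq_bigr => i _; rewrite !linearZ deriveE.
  exact: ex_diff.
apply: differentiable_sum => i.
apply: differentiable_scale.
  apply: (@differentiable_comp _ _ _ _ w (fun v : 'rV[R]_k => v 0 i)) => //.
  exact: differentiable_coord.
exact: (@differentiable_comp _ _ _ _ p ('D_(j (delta_mx 0 i)) F)).
Unshelve. all: by end_near. Qed.

End Differentials.

Section ChartDifferentials.
Context {R : realType}.

(* Differentiability of h at v, read in the preferred chart at q, with
   differential dh; h v need not be q itself. *)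
Record is_chart_diff {V : normedModType R} {n : nat} {M : manifoldType R n}
    (q : M) (h : V -> M) (dh : V -> 'rV[R]_n) (v : V) : Prop := IsChartDiff {
  chart_diff_dom : cdom (chart_at q) (h v);
  chart_diff_continuous : {for v, continuous h};
  chart_diff_diff : is_diff v (chart_coord q \o h) dh }.

Lemma paramK {n} {M : manifoldType R n} (q a : M) :
  cdom (chart_at q) a -> param q (chart_coord q a) = a.
Proof. by move=> qa; apply: cmapK; rewrite inE. Qed.

Lemma cdom_nbhs {n} {M : manifoldType R n} (q a : M) :
  cdom (chart_at q) a -> nbhs a (cdom (chart_at q)).
Proof. by move=> qa; apply: open_nbhs_nbhs; split=> //; exact: cdom_open. Qed.

Lemma near_paramK {V : normedModType R} {n} {M : manifoldType R n} (q : M)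
    (h : V -> M) (v : V) :
  cdom (chart_at q) (h v) -> {for v, continuous h} ->
  \forall u \near v, param q (chart_coord q (h u)) = h u.
Proof.
move=> /cdom_nbhs qh ch; near=> u; apply: paramK.
by near: u; exact: ch.
Unshelve. all: by end_near. Qed.

Lemma cimg_chart_coord {n} {M : manifoldType R n} (q a : M) :
  cdom (chart_at q) a -> cimg (chart_at q) (chart_coord q a).
Proof. by move=> qa; exists a. Qed.

Lemma nbhs_cimg {n} {M : manifoldType R n} (q a : M) :
  cdom (chart_at q) a -> nbhs (chart_coord q a) (cimg (chart_at q)).
Proof.
move=> qa; apply: open_nbhs_nbhs; split; first exact: cimg_open.
exact: cimg_chart_coord.
Qed.

Lemma chart_coord_self {n} {M : manifoldType R n} (q : M) :
  param q (chart_coord q q) = q.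
Proof. by apply: paramK; exact: mem_chart_at. Qed.

Lemma near_eq_is_chart_diff {V : normedModType R} {n} {M : manifoldType R n}
    (q : M) (h k : V -> M) dh (v : V) :
  {near v, h =1 k} -> is_chart_diff q h dh v -> is_chart_diff q k dh v.
Proof.
move=> hk [qh ch dhv]; have hkv := nbhs_singleton hk.
split; first by rewrite -hkv.
  rewrite /prop_for /continuous_at -hkv; apply: cvg_trans ch.
  exact: near_eq_cvg.
apply: near_eq_is_diff dhv; near=> u => /=.
by congr chart_coord; near: u.
Unshelve. all: by end_near.
Qed.

Lemma is_chart_diff_param {n} {M : manifoldType R n} (q a : M) :
  cdom (chart_at q) a -> is_chart_diff q (param q) id (chart_coord q a).
Proof.
move=> qa; split; first by rewrite paramK.
  by apply: cinv_continuous; rewrite inE; exact: cimg_chart_coord.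
apply: (@near_eq_is_diff _ _ _ id).
have := nbhs_cimg qa.
by apply: filterS => u [b qb <-] /=; rewrite -[cmap _ b]/(chart_coord q b) paramK.
Qed.

Lemma is_chart_diff_cst {V : normedModType R} {n} {M : manifoldType R n}
    (q a : M) (v : V) :
  cdom (chart_at q) a -> is_chart_diff q (cst a) 0 v.
Proof.
move=> qa; split=> //; first exact: cst_continuous.
exact: (is_diff_cst (chart_coord q a) v).
Qed.

Lemma is_diff_comp_chart {V W : normedModType R} {n} {M : manifoldType R n}
    (p : M) (f : M -> W) (h : V -> M) df dh (v : V) :
  is_chart_diff p h dh v ->
  is_diff (chart_coord p (h v)) (f \o param p) df ->
  is_diff v (f \o h) (df \o dh).
Proof.
move=> [ph ch dhv] dfh.
apply: (@near_eq_is_diff _ _ _ ((f \o param p) \o (chart_coord p \o h))).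
  by have := near_paramK ph ch; apply: filterS => u /= ->.
Qed.

Lemma is_chart_diff_comp {V : normedModType R} {n k} {M : manifoldType R n}
    {N : manifoldType R k} (p : M) (q : N) (f : M -> N) (h : V -> M)
    df dh (v : V) :
  is_chart_diff p h dh v ->
  is_chart_diff q (f \o param p) df (chart_coord p (h v)) ->
  is_chart_diff q (f \o h) (df \o dh) v.
Proof.
move=> [ph ch dhv] [qf cf dfh].
apply: (@near_eq_is_chart_diff _ _ _ _ ((f \o param p) \o (chart_coord p \o h))).
  by have := near_paramK ph ch; apply: filterS => u /= ->.
split=> //=.
  apply: (@continuous_comp _ _ _ (chart_coord p \o h) (f \o param p)); last exact: cf.
  apply: differentiable_continuous; exact: ex_diff.
exact: (@is_diff_comp _ _ _ _ _ _ (chart_coord q \o (f \o param p))).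
Qed.

Lemma is_chart_diff_comp2 {V : normedModType R} {n1 n2 k}
    {M1 : manifoldType R n1} {M2 : manifoldType R n2} {N : manifoldType R k}
    (p1 : M1) (p2 : M2) (q : N) (f : M1 -> M2 -> N) (h1 : V -> M1) (h2 : V -> M2)
    df dh1 dh2 (v : V) :
  is_chart_diff p1 h1 dh1 v -> is_chart_diff p2 h2 dh2 v ->
  is_chart_diff q (fun u => f (param p1 u.1) (param p2 u.2)) df
    (chart_coord p1 (h1 v), chart_coord p2 (h2 v)) ->
  is_chart_diff q (fun x => f (h1 x) (h2 x)) (fun x => df (dh1 x, dh2 x)) v.
Proof.
move=> [ph1 ch1 dh1v] [ph2 ch2 dh2v] [qf cf dfh].
set F := (fun u => f _ _) in qf cf dfh.
pose c u := (chart_coord p1 (h1 u), chart_coord p2 (h2 u)).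
have dc : is_diff v c (fun x => (dh1 x, dh2 x)) by exact: is_diff_pair.
apply: (@near_eq_is_chart_diff _ _ _ _ (F \o c)).
  by near=> u; rewrite /F /=; congr f; near: u; exact: near_paramK.
split=> //=.
  apply: (@continuous_comp _ _ _ c F); last exact: cf.
  apply: differentiable_continuous; exact: ex_diff.
exact: (@is_diff_comp _ _ _ _ c _ (chart_coord q \o F)).
Unshelve. all: by end_near. Qed.

Lemma is_chart_diff_unique {V : normedModType R} {n} {M : manifoldType R n}
    (q : M) (h : V -> M) dh dh' (v : V) :
  is_chart_diff q h dh v -> is_chart_diff q h dh' v -> dh = dh'.
Proof. by move=> [_ _ [_ <-]] [_ _ [_ <-]]. Qed.

Lemma is_chart_diff_diff {V : normedModType R} {n}
    {M : manifoldType R n} (q : M) (h : V -> M) dh (v : V) :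
  is_chart_diff q h dh v -> is_chart_diff q h ('d (chart_coord q \o h) v) v.
Proof. by case=> qh ch [dhv _]; split; [exact: qh|exact: ch|split]. Qed.

Lemma smooth_into_is_chart_diff {V : normedModType R} {n} {M : manifoldType R n}
    (U : set V) (h : V -> M) (q : M) (v : V) :
  smooth_into U h -> U v -> cdom (chart_at q) (h v) ->
  is_chart_diff q h ('d (chart_coord q \o h) v) v.
Proof.
move=> [ch sh] Uv qh; split=> //; first exact: ch.
by apply: differentiableP; have [dh _] := sh q 1%N; exact: (dh v (conj Uv qh)).
Qed.

Lemma smooth_into_differentiable_derive {V : normedModType R} {n}
    {M : manifoldType R n} (U : set V) (h : V -> M) (q : M) (v w : V) :
  smooth_into U h -> U v -> cdom (chart_at q) (h v) ->
  differentiable ('D_w (chart_coord q \o h)) v.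
Proof.
by move=> [ch sh] Uv qh; have [_ /(_ w)[dh _]] := sh q 2%N; exact: (dh v (conj Uv qh)).
Qed.

End ChartDifferentials.

Section SmoothMaps.
Context {R : realType}.

Definition chart_expr2 {m1 m2 n} {M1 : manifoldType R m1}
    {M2 : manifoldType R m2} {N : manifoldType R n} (p1 : M1) (p2 : M2) (q : N)
    (f : M1 -> M2 -> N) (u : 'rV[R]_m1 * 'rV[R]_m2) : 'rV[R]_n :=
  chart_coord q (f (param p1 u.1) (param p2 u.2)).

Lemma smooth_map_is_chart_diff {m n} {M : manifoldType R m}
    {N : manifoldType R n} (f : M -> N) (p a : M) (q : N) :
  smooth_map f -> cdom (chart_at p) a -> cdom (chart_at q) (f a) ->
  is_chart_diff q (f \o param p) ('d (chart_coord q \o (f \o param p)) (chart_coord p a))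
    (chart_coord p a).
Proof.
move=> sf pa qfa; apply: smooth_into_is_chart_diff (sf p) _ _.
  exact: cimg_chart_coord.
by rewrite /= paramK.
Qed.

Section TwoArguments.
Context {m1 m2 n : nat} {M1 : manifoldType R m1} {M2 : manifoldType R m2}
  {N : manifoldType R n} {f : M1 -> M2 -> N} (sf : smooth_map2 f).
Variables (p1 : M1) (p2 : M2) (q : N).
Let F := chart_expr2 p1 p2 q f.

Lemma smooth_map2_is_chart_diff (V : normedModType R) (h1 : V -> M1)
    (h2 : V -> M2) dh1 dh2 (v : V) :
  is_chart_diff p1 h1 dh1 v -> is_chart_diff p2 h2 dh2 v ->
  cdom (chart_at q) (f (h1 v) (h2 v)) ->
  is_chart_diff q (fun x => f (h1 x) (h2 x))
    (fun x => 'd F (chart_coord p1 (h1 v), chart_coord p2 (h2 v)) (dh1 x, dh2 x))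
    v.
Proof.
move=> h1v h2v qf.
have [[d1 _ _] [d2 _ _]] := (h1v, h2v).
apply: (is_chart_diff_comp2 h1v h2v).
apply: smooth_into_is_chart_diff (sf p1 p2) _ _.
  by split; exact: cimg_chart_coord.
by rewrite /= !paramK.
Qed.

Lemma smooth_map2_differentiable (a : M1) (b : M2) :
  cdom (chart_at p1) a -> cdom (chart_at p2) b -> cdom (chart_at q) (f a b) ->
  differentiable F (chart_coord p1 a, chart_coord p2 b).
Proof.
move=> pa pb qf.
have Uab : (cimg (chart_at p1) `*` cimg (chart_at p2))
    (chart_coord p1 a, chart_coord p2 b) by split; exact: cimg_chart_coord.
have [] // := smooth_into_is_chart_diff (q := q) (sf p1 p2) Uab.
  by rewrite /= !paramK.
Qed.

Lemma smooth_map2_differentiable_derive (a : M1) (b : M2) w :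
  cdom (chart_at p1) a -> cdom (chart_at p2) b -> cdom (chart_at q) (f a b) ->
  differentiable ('D_w F) (chart_coord p1 a, chart_coord p2 b).
Proof.
move=> pa pb qf.
have Uab : (cimg (chart_at p1) `*` cimg (chart_at p2))
    (chart_coord p1 a, chart_coord p2 b) by split; exact: cimg_chart_coord.
apply: (smooth_into_differentiable_derive (q := q) w (sf p1 p2) Uab).
by rewrite /= !paramK.
Qed.

End TwoArguments.

End SmoothMaps.

Section AdjointRepresentation.
Context {R : realType} {d : nat} {G : lieGroupType R d}.
Notation c1 := (chart_coord (1%g : G) 1%g).
Notation mulG := (fun g h : G => (g * h)%g).
Notation cdom1 := (cdom (chart_at (1%g : G))).

Lemma conj1 (g : G) : (g * 1 * g^-1 = 1)%g.
Proof. by rewrite mulg1 mulgV. Qed.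

Lemma is_chart_diff_conj_chart (p p' g : G) :
  cdom (chart_at p) g -> cdom (chart_at p') g^-1%g ->
  is_chart_diff 1%g ((fun a : G => (g * a * g^-1)%g) \o param 1%g)
    (fun y => 'd (chart_expr2 p p' 1%g mulG) (chart_coord p g, chart_coord p' g^-1%g)
      ('d (chart_expr2 p 1%g p mulG) (chart_coord p g, c1) (0, y), 0)) c1.
Proof.
move=> pg pg'.
have g1 : (g * param (1%g : G) c1)%g = g by rewrite chart_coord_self mulg1.
have gl : is_chart_diff p (fun u => (g * param 1 u)%g)
    (fun y => 'd (chart_expr2 p 1%g p mulG) (chart_coord p g, c1) (0, y)) c1.
  have := smooth_map2_is_chart_diff (q := p) smooth_mulg (is_chart_diff_cst c1 pg)
    (is_chart_diff_param (mem_chart_at (1%g : G))).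
  by rewrite !g1 chart_coord_self; apply.
have := smooth_map2_is_chart_diff (q := 1%g) smooth_mulg gl (is_chart_diff_cst c1 pg').
by rewrite !g1; apply; rewrite mulgV; exact: mem_chart_at.
Qed.

Lemma is_chart_diff_conj (g : G) :
  is_chart_diff 1%g ((fun a : G => (g * a * g^-1)%g) \o param 1%g) (Ad g) c1.
Proof.
have [qc cc [dc dcE]] := is_chart_diff_conj_chart (mem_chart_at g) (mem_chart_at g^-1%g).
by rewrite /Ad /tmap /dfun conj1; split; [exact: qc|exact: cc|split].
Qed.

Lemma AdE (g : G) (y : 'rV[R]_d) : cdom1 g -> cdom1 g^-1%g ->
  Ad g y = 'd (chart_expr2 1%g 1%g 1%g mulG)
    (chart_coord (1%g : G) g, chart_coord (1%g : G) g^-1%g)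
    ('d (chart_expr2 1%g 1%g 1%g mulG) (chart_coord (1%g : G) g, c1) (0, y), 0).
Proof.
move=> g1 g1'.
by rewrite (is_chart_diff_unique (is_chart_diff_conj g) (is_chart_diff_conj_chart g1 g1')).
Qed.

Lemma Ad_linear (g : G) : linear (Ad g).
Proof. by move=> a u v; rewrite /Ad /tmap /dfun linearP. Qed.

Lemma near_one_inv :
  \forall u \near c1, [/\ chart_coord (1%g : G) (param (1%g : G) u) = u,
    cdom1 (param (1%g : G) u) & cdom1 (param (1%g : G) u)^-1%g].
Proof.
have one := mem_chart_at (1%g : G).
have one' : cdom1 (1^-1%g : G) by rewrite invg1.
have [_ c _] := is_chart_diff_param one.
have [_ c' _] := smooth_map_is_chart_diff smooth_invg one one'.
near=> u; split; near: u.
- apply: filterS (nbhs_cimg one) => u [a a1 <-] /=.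
  by rewrite -[cmap _ a]/(chart_coord _ a) paramK.
- by apply: c; rewrite chart_coord_self; exact: cdom_nbhs.
by apply: c'; rewrite /= chart_coord_self; exact: cdom_nbhs.
Unshelve. all: by end_near. Qed.

Lemma differentiable_Ad (y : 'rV[R]_d) :
  differentiable ((fun g : G => Ad g y) \o param 1%g) c1.
Proof.
pose F := chart_expr2 (1%g : G) (1%g : G) (1%g : G) mulG.
pose i u := chart_coord (1%g : G) (param (1%g : G) u)^-1%g.
pose j (v : 'rV[R]_d) : 'rV[R]_d * 'rV[R]_d := (v, 0).
have jlin : linear j by move=> a u v; apply: injective_projections; rewrite //= scaler0 addr0.
pose jM := GRing.isLinear.Build _ _ _ _ _ jlin.
pose jL : {linear 'rV[R]_d -> ('rV[R]_d * 'rV[R]_d)%type} := HB.pack j jM.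
have one := mem_chart_at (1%g : G).
have one' : cdom1 (1^-1%g : G) by rewrite invg1.
have oneone : cdom1 (1 * 1 : G)%g by rewrite mulg1.
have ic1 : i c1 = c1 by rewrite /i chart_coord_self invg1.
have di : differentiable i c1.
  by have [_ _ [di _]] := smooth_map_is_chart_diff smooth_invg one one'.
pose w u := 'D_(0, y) F (u, c1).
have dw : differentiable w c1.
  apply: (@differentiable_comp _ _ _ _ (fun u => (u, c1)) ('D_(0, y) F)).
    by apply: differentiable_pair.
  exact: (smooth_map2_differentiable_derive smooth_mulg _ one one oneone).
suff dA : is_diff c1 ((fun g : G => Ad g y) \o param 1%g)
    ('d (fun u => 'd F (u, i u) (jL (w u))) c1) by exact: ex_diff.
have dFA : differentiable (fun u => 'd F (u, i u) (jL (w u))) c1.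
  apply: (@differentiable_diff_apply R d _ _ _ F jL (fun u => (u, i u))) => //.
  - apply: filterS near_one_inv => u [uK u1 u2].
    have := smooth_map2_differentiable (q := 1%g) smooth_mulg u1 u2.
    by rewrite uK; apply; rewrite mulgV.
  - move=> v; rewrite ic1; exact: (smooth_map2_differentiable_derive smooth_mulg _ one one oneone).
  - by apply: differentiable_pair.
apply: near_eq_is_diff (differentiableP dFA).
apply: filterS near_one_inv => u [uK u1 u2] /=.
rewrite AdE // uK /w deriveE //.
have := smooth_map2_differentiable (q := 1%g) smooth_mulg u1 one.
by rewrite uK; apply; rewrite mulg1.
Qed.

End AdjointRepresentation.

Section LieAlgebra.
Context {R : realType} {d : nat} {G : lieGroupType R d}.
Context {lexp : 'rV[R]_d -> G} (hexp : is_exponential lexp).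
Implicit Types x y z : 'rV[R]_d.
Notation c1 := (chart_coord (1%g : G) 1%g).

Lemma lexp0 : lexp 0 = 1%g.
Proof.
have [_ + _] := hexp 0 => /(_ 0 0); rewrite !scaler0.
by move/(congr1 (fun g => (lexp 0)^-1 * g)%g); rewrite mulVg mulKg.
Qed.

Lemma lexpN x : lexp (- x) = (lexp x)^-1%g.
Proof.
have [_ + _] := hexp x => /(_ (-1) 1); rewrite addNr scale0r scaleN1r scale1r lexp0.
by move/esym/(congr1 (fun g => g * (lexp x)^-1)%g); rewrite mulgK mul1g.
Qed.

Lemma is_chart_diff_lexp x :
  is_chart_diff 1%g (fun t : R => lexp (t *: x)) (fun t => t *: x) 0.
Proof.
have [sx _ vx] := hexp x.
have := @smooth_into_is_chart_diff R R^o d G setT (fun t : R => lexp (t *: x)) 1%g 0 sx I.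
rewrite scale0r lexp0 => /(_ (mem_chart_at _)).
set D := 'd _ _ => -[q1 c1' dD]; split=> //.
suff DE : (D : R -> _) = (fun t => t *: x) by rewrite -DE.
rewrite funeqE => t; rewrite -vx /velocity scale0r lexp0.
rewrite (@is_diff_derive1 _ _ _ _ _ dD).
by rewrite -[in LHS](mulr1 t) -[t * 1]/(t *: (1 : R^o)) linearZ.
Qed.

Lemma Ad_lexp (t : R) x : Ad (lexp (t *: x)) x = x.
Proof.
have l0 : lexp (0 *: x) = 1%g by rewrite scale0r lexp0.
have := is_chart_diff_comp (q := 1%g) (df := Ad (lexp (t *: x)))
  (f := fun a : G => (lexp (t *: x) * a * (lexp (t *: x))^-1)%g)
  (is_chart_diff_lexp x).
rewrite l0 => /(_ (is_chart_diff_conj (lexp (t *: x)))).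
rewrite (_ : _ \o _ = fun s : R => lexp (s *: x)).
  move/is_chart_diff_unique => /(_ _ (is_chart_diff_lexp x)).
  by move/(congr1 (fun f => f 1)); rewrite /= scale1r.
by rewrite funeqE => s /=; have [_ e _] := hexp x; rewrite -e addrC e mulgK.
Qed.

Lemma is_diff_Ad_lexp x y :
  is_diff 0 (fun t : R => Ad (lexp (t *: x)) y)
    (fun t => t *: lie_bracket (G := G) x y).
Proof.
have dA := differentiableP (@differentiable_Ad _ _ G y).
have := is_diff_comp_chart (is_chart_diff_lexp x) (f := fun g => Ad g y).
rewrite scale0r lexp0 => /(_ _ dA).
suff -> : (fun t : R => t *: lie_bracket (G := G) x y) =
  'd ((fun g : G => Ad g y) \o param 1%g) c1 \o (fun t : R => t *: x) by [].
by rewrite funeqE => t /=; rewrite linearZ.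
Qed.

Lemma derive1_Ad_lexp x y :
  derive1 (fun t : R => Ad (lexp (t *: x)) y) 0 = lie_bracket (G := G) x y.
Proof. by rewrite (is_diff_derive1 (is_diff_Ad_lexp x y)) scale1r. Qed.

Lemma lie_bracket_linearl y : linear (fun x => lie_bracket (G := G) x y).
Proof. by move=> a u v; rewrite /lie_bracket /dfun linearP. Qed.

Lemma lie_bracketNl x y : lie_bracket (G := G) (- x) y = - lie_bracket (G := G) x y.
Proof. by rewrite /lie_bracket /dfun linearN. Qed.

Lemma lie_bracket_linearr x : linear (lie_bracket (G := G) x).
Proof.
move=> a y z; rewrite /lie_bracket /dfun.
have dy := differentiableP (@differentiable_Ad _ _ G y).
have dz := differentiableP (@differentiable_Ad _ _ G z).
have e : (fun g : G => Ad g (a *: y + z)) \o param 1%g = (fun u =>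
    a *: ((fun g : G => Ad g y) \o param 1%g) u + ((fun g : G => Ad g z) \o param 1%g) u).
  by rewrite funeqE => u; exact: Ad_linear.
have [_ dyz] := is_diff_linear_comb a dy dz.
by rewrite e; exact: (congr1 (fun f => f x) dyz).
Qed.

Lemma lie_bracketxx x : lie_bracket (G := G) x x = 0.
Proof.
rewrite -derive1_Ad_lexp [X in derive1 X](_ : _ = cst x) ?derive1_cst //.
by rewrite funeqE => t; exact: Ad_lexp.
Qed.

Lemma lie_bracketC x y : lie_bracket (G := G) y x = - lie_bracket (G := G) x y.
Proof.
have l z : {morph (fun x => lie_bracket (G := G) x z) : x y / x + y}.
  by move=> u v; have := lie_bracket_linearl z 1 u v; rewrite !scale1r.
have r z : {morph (lie_bracket (G := G) z) : x y / x + y}.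
  by move=> u v; have := lie_bracket_linearr z 1 u v; rewrite !scale1r.
apply/eqP; rewrite -addr_eq0 addrC; apply/eqP.
by have := lie_bracketxx (x + y); rewrite l !r !lie_bracketxx add0r addr0.
Qed.

End LieAlgebra.

Section Action.
Context {R : realType} {d n : nat} {G : lieGroupType R d} {M : manifoldType R n}.
Context {act : G -> M -> M} (hact : is_smooth_action act).
Context {lexp : 'rV[R]_d -> G} (hexp : is_exponential lexp).
Variable m : M.
Notation c1 := (chart_coord (1%g : G) 1%g).
Notation cm := (chart_coord m m).
Notation rho := (isotropy act m).

Definition dorbit : 'rV[R]_d -> 'rV[R]_n := tmap (act^~ m) 1%g.

Lemma dorbit_linear : linear dorbit.
Proof. by move=> a u v; rewrite /dorbit /tmap /dfun linearP. Qed.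

Lemma isotropy_linear g : linear (rho g).
Proof. by move=> a u v; rewrite /isotropy /tmap /dfun linearP. Qed.

Lemma is_chart_diff_act_chart (p g : G) (q : M) :
  cdom (chart_at p) g -> cdom (chart_at q) (act g m) ->
  is_chart_diff q (act g \o param m)
    (fun v => 'd (chart_expr2 p m q act) (chart_coord p g, cm) (0, v)) cm.
Proof.
move=> pg qg.
have := smooth_map2_is_chart_diff (q := q) (act_smooth hact)
  (is_chart_diff_cst cm pg) (is_chart_diff_param (mem_chart_at m)).
by rewrite !chart_coord_self; apply.
Qed.

Lemma is_chart_diff_act g :
  is_chart_diff (act g m) (act g \o param m) (rho g) cm.
Proof.
exact: is_chart_diff_diff (is_chart_diff_act_chart (mem_chart_at g) (mem_chart_at _)).
Qed.

Lemma is_chart_diff_orbit :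
  is_chart_diff m (act^~ m \o param 1%g) dorbit c1.
Proof.
have mm : cdom (chart_at m) (act 1%g m) by rewrite act_one //; exact: mem_chart_at.
have := smooth_map2_is_chart_diff (q := m) (act_smooth hact)
  (is_chart_diff_param (mem_chart_at (1%g : G))) (is_chart_diff_cst c1 (mem_chart_at m)).
rewrite !chart_coord_self => /(_ mm)/is_chart_diff_diff.
by rewrite /dorbit /tmap /dfun act_one.
Qed.

Lemma infgenE x : infgen act lexp x m = dorbit x.
Proof.
have := is_chart_diff_comp (q := m) (f := act^~ m) (df := dorbit)
  (is_chart_diff_lexp hexp x).
rewrite scale0r (lexp0 hexp) => /(_ is_chart_diff_orbit) [_ _ dc].
rewrite /infgen /velocity scale0r (lexp0 hexp) act_one //.
by rewrite (is_diff_derive1 dc) /= scale1r.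
Qed.

Lemma isotropy1 v : rho 1%g v = v.
Proof.
have := is_chart_diff_act 1%g; rewrite act_one // => d1.
have := is_chart_diff_param (mem_chart_at m).
have {1}-> : param m = act 1%g \o param m.
  by rewrite funeqE => u /=; rewrite act_one.
by move/(is_chart_diff_unique d1)/(congr1 (fun f => f v)).
Qed.

Lemma isotropyM g h v : stab act m h -> rho (g * h)%g v = rho g (rho h v).
Proof.
rewrite /stab /= => hm.
have := is_chart_diff_act h; rewrite hm => dh.
have := is_chart_diff_comp (q := act g m) (f := act g) (df := rho g) dh.
rewrite /= chart_coord_self hm => /(_ (is_chart_diff_act g)).
have := is_chart_diff_act (g * h)%g; rewrite act_mul // hm => dgh.
rewrite (_ : act g \o _ = act (g * h)%g \o param m); last first.
  by rewrite funeqE => u /=; rewrite act_mul.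
by move/(is_chart_diff_unique dgh) => ->.
Qed.

Lemma isotropy_dorbit g x : stab act m g -> rho g (dorbit x) = dorbit (Ad g x).
Proof.
rewrite /stab /= => gm.
have dg : is_chart_diff m (act g \o param m) (rho g) cm.
  by have := is_chart_diff_act g; rewrite gm.
have := is_chart_diff_comp (q := m) (f := act g) (df := rho g) is_chart_diff_orbit.
rewrite /= chart_coord_self act_one // => /(_ dg).
have := is_chart_diff_comp (q := m) (f := act^~ m) (df := dorbit) (is_chart_diff_conj g).
rewrite /= chart_coord_self conj1 => /(_ is_chart_diff_orbit).
rewrite (_ : act^~ m \o _ = act g \o (act^~ m \o param 1%g)); last first.
  rewrite funeqE => u /=; rewrite !act_mul //.
  have -> // : act g^-1%g m = m.
  by rewrite -[in LHS]gm -act_mul // mulVg act_one.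
by move=> h1 /is_chart_diff_unique => /(_ _ h1) /(congr1 (fun f => f x)).
Qed.

Section IsotropyGenerator.
Variable eta : 'rV[R]_d.
Hypothesis eta_stab : forall t : R, stab act m (lexp (t *: eta)).
Notation D := (isotropy_gen act lexp m eta).

Lemma differentiable_isotropy v :
  differentiable (fun t : R => rho (lexp (t *: eta)) v) 0.
Proof.
pose F := chart_expr2 (1%g : G) m m act.
have l0 : lexp (0 *: eta) = 1%g by rewrite scale0r (lexp0 hexp).
have one := mem_chart_at (1%g : G); have mm := mem_chart_at m.
have [ql cl dl] := is_chart_diff_lexp hexp eta.
pose c (t : R) := (chart_coord (1%g : G) (lexp (t *: eta)), cm).
have dc : differentiable ('D_(0, v) F \o c) 0.
  apply: differentiable_comp.
    by apply: differentiable_pair => //; exact: ex_diff dl.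
  rewrite /c l0.
  have onem : cdom (chart_at m) (act 1%g m) by rewrite act_one.
  exact: (smooth_map2_differentiable_derive (act_smooth hact) _ one mm onem).
suff H : is_diff 0 (fun t : R => rho (lexp (t *: eta)) v) ('d ('D_(0, v) F \o c) 0).
  by case: H => dH _; exact: dH.
apply: near_eq_is_diff (differentiableP dc).
near=> t => /=; have t1 : cdom (chart_at (1%g : G)) (lexp (t *: eta)).
  by near: t; apply: cl; exact: cdom_nbhs.
have gm := eta_stab t; rewrite /stab /= in gm.
have mg : cdom (chart_at m) (act (lexp (t *: eta)) m) by rewrite gm.
have := is_chart_diff_act (lexp (t *: eta)); rewrite gm.
move=> /is_chart_diff_unique => /(_ _ (is_chart_diff_act_chart t1 mg)) ->.
by rewrite deriveE //; exact: (smooth_map2_differentiable (act_smooth hact) t1 mm mg).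
Unshelve. all: by end_near. Qed.

Lemma scalar_isotropy_gen (f : 'rV[R]_n -> R) v : scalar f ->
  derive1 (fun t : R => f (rho (lexp (t *: eta)) v)) 0 = f (D v).
Proof. by move=> lf; exact: derive1_scalar_comp lf (differentiable_isotropy v). Qed.

Lemma isotropy_gen_linear : linear D.
Proof.
move=> a u v.
have du := differentiableP (differentiable_isotropy u).
have dv := differentiableP (differentiable_isotropy v).
rewrite /isotropy_gen (is_diff_derive1 du) (is_diff_derive1 dv).
have -> : (fun t : R => rho (lexp (t *: eta)) (a *: u + v)) = (fun t : R =>
    a *: rho (lexp (t *: eta)) u + rho (lexp (t *: eta)) v).
  by rewrite funeqE => t; exact: isotropy_linear.
exact: (is_diff_derive1 (is_diff_linear_comb a du dv)).
Qed.

Lemma isotropy_gen_dorbit x :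
  D (dorbit x) = dorbit (lie_bracket (G := G) eta x).
Proof.
rewrite /isotropy_gen.
have -> : (fun t => rho (lexp (t *: eta)) (dorbit x)) =
    dorbit \o (fun t : R => Ad (lexp (t *: eta)) x).
  by rewrite funeqE => t /=; rewrite isotropy_dorbit.
pose LM := GRing.isLinear.Build _ _ _ _ dorbit dorbit_linear.
pose L : {linear 'rV[R]_d -> 'rV[R]_n} := HB.pack dorbit LM.
have := is_diff_derive1 (is_diff_linear_mx L (is_diff_Ad_lexp hexp eta x)).
by rewrite /= scale1r.
Qed.

End IsotropyGenerator.

End Action.

Section Duality.
Context {R : realType} {d : nat}.
Implicit Types (lam : 'cV[R]_d) (x : 'rV[R]_d).

Lemma pairing_scalar lam : scalar (pairing lam).
Proof. by move=> a u v; rewrite /pairing mulmxDl -scalemxAl !mxE. Qed.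

Lemma pairingNl lam x : pairing (- lam) x = - pairing lam x.
Proof. by rewrite /pairing mulmxN mxE. Qed.

Lemma pairingNr lam x : pairing lam (- x) = - pairing lam x.
Proof. by rewrite /pairing mulNmx mxE. Qed.

Lemma pairing0l x : pairing 0 x = 0.
Proof. by rewrite /pairing mulmx0 mxE. Qed.

Lemma pairing_linearl x : linear (fun lam => pairing lam x : R^o).
Proof. by move=> a l k; rewrite /pairing mulmxDr -scalemxAr !mxE. Qed.

Lemma pairing_functional (F : 'rV[R]_d -> R) x :
  scalar F -> pairing (functional F) x = F x.
Proof.
move=> lF.
pose FM := GRing.isLinear.Build R 'rV[R]_d R^o _ (F : 'rV[R]_d -> R^o) lF.
pose FL : {linear 'rV[R]_d -> R^o} := HB.pack (F : 'rV[R]_d -> R^o) FM.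
rewrite -[F x]/(FL x) [in RHS](row_sum_delta x) linear_sum /pairing mxE.
by apply: eq_bigr => i _; rewrite linearZ mxE.
Qed.

Lemma pairing_coad (G : lieGroupType R d) x lam y :
  pairing (coad G x lam) y = pairing lam (lie_bracket (G := G) x y).
Proof.
rewrite pairing_functional // => a u v.
by rewrite lie_bracket_linearr pairing_scalar.
Qed.

End Duality.

Section HamiltonianAction.
Context {R : realType} {d n : nat} {G : lieGroupType R d} {M : manifoldType R n}.
Context {act : G -> M -> M} (hact : is_smooth_action act).
Context {lexp : 'rV[R]_d -> G} (hexp : is_exponential lexp).
Context {omega : M -> 'rV[R]_n -> 'rV[R]_n -> R}.
Hypothesis homega : is_symplectic_form omega.
Hypothesis hpres : preserves_form act omega.
Context {Phi : M -> 'cV[R]_d}.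
Hypothesis hPhi : is_momentum_map act lexp omega Phi.
Variable m : M.
Notation L := (dorbit (act := act) m).

Lemma omega_scalarl p v : scalar (omega p ^~ v).
Proof.
move=> a u1 u2 /=; rewrite !(symp_skew homega p v).
by rewrite (symp_linear homega) opprD mulrN.
Qed.

Lemma omegaDl p u v w : omega p (u + v) w = omega p u w + omega p v w.
Proof. by have := omega_scalarl p w 1 u v; rewrite scale1r mul1r. Qed.

Lemma omega0l p v : omega p 0 v = 0.
Proof. by have := omegaDl p 0 0 v; rewrite add0r => /eqP; rewrite -subr_eq subrr => /eqP. Qed.

Lemma omegaNl p u v : omega p (- u) v = - omega p u v.
Proof. by apply/eqP; rewrite -addr_eq0 -omegaDl addNr omega0l. Qed.

Lemma is_diff_momentum x :
  is_diff (chart_coord m m) ((fun q => pairing (Phi q) x : R^o) \o param m)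
    (fun v => pairing (dfun Phi m v) x).
Proof.
have dPhi : differentiable (Phi \o param m) (chart_coord m m).
  have [H _] := momentum_smooth hPhi m 1%N.
  by apply: H; apply: cimg_chart_coord; exact: mem_chart_at.
pose pM := GRing.isLinear.Build _ _ _ _ _ (pairing_linearl x).
pose pL : {linear 'cV[R]_d -> R^o} := HB.pack (fun lam => pairing lam x : R^o) pM.
exact: (is_diff_linear_mx pL (differentiableP dPhi)).
Qed.

Lemma omega_dorbit x v : omega m (L x) v = pairing (dfun Phi m v) x.
Proof.
rewrite -(infgenE hact hexp m x) (momentum_eq hPhi) /dfun.
by have [_ ->] := is_diff_momentum x.
Qed.

Lemma omega_dorbit_dorbit x y :
  omega m (L x) (L y) = pairing (Phi m) (lie_bracket (G := G) x y).
Proof.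
rewrite omega_dorbit.
set f := fun q => pairing (Phi q) x : R^o.
have := is_chart_diff_comp (q := m) (f := act^~ m) (df := L)
  (is_chart_diff_lexp hexp y).
rewrite scale0r (lexp0 hexp) => /(_ (is_chart_diff_orbit hact m)).
move=> /is_diff_comp_chart; move=> /(_ _ f).
rewrite /= scale0r (lexp0 hexp) act_one // => /(_ _ (is_diff_momentum x)).
move=> /is_diff_derive1; rewrite /= scale1r => <-.
have -> : f \o (act^~ m \o (fun t : R => lexp (t *: y))) =
    pairing (Phi m) \o (fun t : R => Ad (lexp (t *: - y)) x).
  rewrite funeqE => t /=.
  by rewrite /f (momentum_equivariant hPhi) -(lexpN hexp) scalerN.
rewrite derive1_scalar_comp; last 2 first.
- exact: pairing_scalar.
- by have [] := is_diff_Ad_lexp hexp (- y) x.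
rewrite (derive1_Ad_lexp hexp).
by rewrite lie_bracketNl (lie_bracketC hexp x y) opprK.
Qed.

Section IsotropyGenerator.
Variable eta : 'rV[R]_d.
Hypothesis eta_stab : forall t : R, stab act m (lexp (t *: eta)).
Notation rho := (isotropy act m).
Notation D := (isotropy_gen act lexp m eta).

Lemma isotropy_genN v : isotropy_gen act lexp m (- eta) v = - D v.
Proof.
have e : (fun t : R => rho (lexp (t *: - eta)) v) =
    fun t : R => rho (lexp ((- t) *: eta)) v.
  rewrite funeqE => t.
  by rewrite (_ : t *: - eta = (- t) *: eta) // scalerN scaleNr.
apply: etrans (congr1 (fun c => derive1 c 0) e) _.
exact: (derive1_compN (differentiable_isotropy hact hexp eta_stab v)).
Qed.

Lemma omega_isotropy_gen u v : omega m (D u) v = - omega m u (D v).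
Proof.
have stabN (t : R) : stab act m (lexp (t *: - eta)).
  by rewrite scalerN -scaleNr.
have su := scalar_isotropy_gen hact hexp eta_stab.
rewrite -(su (fun w => omega m w v) u (omega_scalarl m v)).
have -> : (fun t : R => omega m (rho (lexp (t *: eta)) u) v) =
    fun t : R => omega m u (rho (lexp (t *: - eta)) v).
  rewrite funeqE => t.
  set g := lexp (t *: eta); set g' := lexp (t *: - eta).
  have gg' : (g * g' = 1)%g by rewrite /g' scalerN (lexpN hexp) mulgV.
  have rr : rho g (rho g' v) = v.
    by rewrite -(isotropyM hact g v (stabN t)) gg' (isotropy1 hact).
  have : omega (act g m) (rho g u) (rho g (rho g' v)) = omega m u (rho g' v).
    exact: hpres.
  by rewrite (eta_stab t) rr.
rewrite (scalar_isotropy_gen hact hexp stabN v (symp_linear homega m u)).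
by rewrite isotropy_genN !(symp_skew homega m _ u) omegaNl.
Qed.

Lemma omega_isotropy_genC u v : omega m (D u) v = omega m (D v) u.
Proof. by rewrite omega_isotropy_gen -(symp_skew homega). Qed.

Lemma omega_isotropy_gen0 u v :
  (forall t : R, omega m (rho (lexp (t *: eta)) u) v = 0) -> omega m (D u) v = 0.
Proof.
move=> uv; rewrite -(scalar_isotropy_gen hact hexp eta_stab _ (omega_scalarl m v)).
by under eq_fun do rewrite uv; rewrite derive1_cst.
Qed.

End IsotropyGenerator.

End HamiltonianAction.

Lemma biadditive_sqrD4 {R : comPzRingType} {V : zmodType} (B : V -> V -> R)
    (x b w n : V) :
  (forall u v z, B (u + v) z = B u z + B v z) -> (forall u v, B u v = B v u) ->
  B (x + (b + w) + n) (x + (b + w) + n) = B x x + B b b + B w w + B n n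
    + 2%:R * (B x b + B x w + B x n + B b w + B b n + B w n).
Proof.
move=> BD BC; have BDr u v z : B z (u + v) = B z u + B z v by rewrite BC BD !(BC _ z).
rewrite !BD !BDr (BC b x) (BC w x) (BC n x) (BC w b) (BC n b) (BC n w).
ring.
Qed.

Unset Implicit Arguments.

Theorem proposition4p6 (R : realType) (n d e : nat)
    (M : manifoldType R n) (G : lieGroupType R d) (H : lieGroupType R e)
    (omega : M -> 'rV[R]_n -> 'rV[R]_n -> R)
    (act : G -> M -> M) (lexp : 'rV[R]_d -> G) (Phi : M -> 'cV[R]_d)
    (iota : H -> G) (m : M)
    (homega : is_symplectic_form omega)
    (hexp : is_exponential lexp)
    (hact : is_smooth_action act)
    (hproper : is_proper_action act)
    (hpres : preserves_form act omega)
    (hPhi : is_momentum_map act lexp omega Phi)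
    (hH : is_lie_subgroup iota) :
  let PhiH : M -> 'cV[R]_e := fun p => dual_restr iota (Phi p) in
  let mu := Phi m in
  let alpha := PhiH m in
  let Gm : set G := stab act m in
  let Hm : set H := [set h | act (iota h) m = m] in
  let h : set 'rV[R]_d := range (lie_incl iota) in
  let gm := lie_of lexp Gm in
  let hm := h `&` lie_of lexp (iota @` Hm) in
  let gmu : set 'rV[R]_d := [set x | coad G x mu = 0] in
  let hmu := h `&` gmu in
  let halpha : set 'rV[R]_d :=
    [set lie_incl iota y | y in [set y | coad H y alpha = 0]] in
  let dot : set 'rV[R]_d -> set 'rV[R]_n := orbit_dir act lexp m in
  let xM : 'rV[R]_d -> 'rV[R]_n := fun x => infgen act lexp x m in
  let hperp : set 'rV[R]_d := [set x | symp_orth omega m (dot h) (xM x)] in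
  let kerPhi : set 'rV[R]_n := [set v | dfun Phi m v = 0] in
  let kerPhiH : set 'rV[R]_n := [set v | dfun PhiH m v = 0] in
  (* standing assumption (A) *)
  forall (hA : forall k, Gm k ->
      [set (k * g * k^-1)%g | g in range iota] = range iota),
  (* choices in the Lie algebra of G *)
  forall p b a s nt hc : set 'rV[R]_d,
  forall (hp : direct_sum hmu hm p) (hp_inv : invariant_under Gm Ad p)
    (hb : direct_sum gmu (sumset gm hmu) b) (hb_inv : invariant_under Gm Ad b)
    (ha : direct_sum halpha hmu a) (ha_inv : invariant_under Gm Ad a)
    (hs : direct_sum hperp (sumset gmu halpha) s) (hs_inv : invariant_under Gm Ad s)
    (hnt : direct_sum h halpha nt) (hnt_inv : invariant_under Gm Ad nt)
    (hhc : direct_sum setT hperp hc) (hhc_inv : invariant_under Gm Ad hc)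
    (hnt_hc : nt `<=` hc),
  let q := sumset a s in
  let mm := sumset p b in
  let nn := sumset q hc in
  (* Witt-Artin decomposition relative to G *)
  let T0 := dot gmu in
  let T1 := dot nn in
  forall N0 N1 : set 'rV[R]_n,
  forall (hN1 : direct_sum kerPhi T0 N1)
    (hN1_inv : invariant_under Gm (isotropy act m) N1)
    (hN0 : direct_sum (symp_orth omega m (sumset T1 N1)) T0 N0)
    (hN0_lag : lagrangian_in omega m (symp_orth omega m (sumset T1 N1)) N0)
    (hN0_inv : invariant_under Gm (isotropy act m) N0),
  (* the map f, with values extended by 0 on gm + nn *)
  forall f : 'rV[R]_n -> 'cV[R]_d,
  forall (hf : forall w, N0 w ->
      [/\ forall y, mm y -> pairing (f w) y = omega m (xM y) w,
          forall y, gm y -> pairing (f w) y = 0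
        & forall y, nn y -> pairing (f w) y = 0]),
  (* symplectic slice relative to H *)
  forall Xm Ym Nt1 : set 'rV[R]_n,
  forall (hYm : Ym `<=` N0) (hYm_iso : iso_to_dual Ym b)
    (hXm : direct_sum Xm (dot b) Ym)
    (hsX : direct_sum (sumset (dot s) Xm) (dot s) Xm)
    (hNt1_dec : direct_sum Nt1 (sumset (dot s) Xm) N1)
    (hNt1 : direct_sum kerPhiH (dot halpha) Nt1)
    (hNt1_inv : invariant_under Hm (fun k => isotropy act m (iota k)) Nt1),
  forall (eta x b' : 'rV[R]_d) (w nu : 'rV[R]_n),
    hm eta -> s x -> b b' -> Ym w -> N1 nu ->
  linear_momentum act lexp omega m (xM x + (xM b' + w) + nu) eta
  = 2%:R^-1 * pairing (coad G x (coad G x mu)) eta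
    + pairing (- coad G b' (f w)) eta
    + 2%:R^-1 * omega m (isotropy_gen act lexp m eta nu) nu.
Proof.
move=> PhiH mu alpha Gm Hm h gm hm gmu hmu halpha dot xM hperp kerPhi kerPhiH
  _ p b a s nt hc hp _ hb hb_inv ha _ hs hs_inv _ _ hhc _ _ q mm nn T0 T1 N0 N1
  hN1 _ _ hN0_lag hN0_inv f hf Xm Ym Nt1 hYm _ _ _ _ _ _
  eta x b' w nu [_ eta_lie] sx bb' Yw N1nu.
have stab_eta t : stab act m (lexp (t *: eta)).
  by have [k km <-] := eta_lie t.
have N0w := hYm _ Yw.
have [_ [N10 _] _ kerE] := hN1.
have [_ [b0 _] _ gmuE] := hb.
have [_ [p0 _] _ _] := hp.
have [_ [a0 _] _ _] := ha.
have [_ [s0 _] _ _] := hs.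
have [_ [hc0 _] _ _] := hhc.
pose L := dorbit (act := act) m.
have xME y : xM y = L y by exact: infgenE.
have L0 : L 0 = 0 by rewrite /L /dorbit /tmap /dfun linear0.
have nn_s y : s y -> nn y.
  move=> sy; exists y; last by exists 0; rewrite ?addr0.
  by exists 0; [exact: a0 | exists y; rewrite ?add0r].
have mm_b y : b y -> mm y.
  by move=> by_; exists 0; [exact: p0 | exists y; rewrite ?add0r].
have T1_dorbit y : nn y -> T1 (L y) by move=> ny; exists y => //; exact: xME.
have T10 : T1 0 by rewrite -L0; apply: T1_dorbit; exact: nn_s.
have [_ N0E] := hN0_lag.
have N0_orth v : N0 v -> symp_orth omega m (sumset T1 N1) v by rewrite N0E => -[].
have N0_isotropic u v : N0 u -> N0 v -> omega m u v = 0.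
  by move=> N0u; rewrite {1}N0E => -[+ _]; exact.
have orth_s y v : s y -> N0 v -> omega m (L y) v = 0.
  move=> sy /N0_orth; apply; exists (L y); first by apply: T1_dorbit; exact: nn_s.
  by exists 0; rewrite ?addr0.
have orth_N1 u v : N1 u -> N0 v -> omega m u v = 0.
  by move=> N1u /N0_orth; apply; exists 0 => //; exists u; rewrite ?add0r.
have ker_nu : dfun Phi m nu = 0.
  have : kerPhi nu.
    rewrite kerE; exists 0; last by exists nu; rewrite ?add0r.
    by have [[]] := hN1.
  by [].
have orth_nu y : omega m (L y) nu = 0.
  by rewrite (omega_dorbit hact hexp hPhi) ker_nu pairing0l.
have gmu_b : coad G b' mu = 0.
  have : gmu b'.
    rewrite gmuE; exists 0; last by exists b'; rewrite ?add0r.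
    by have [[]] := hb.
  by [].
have orth_b y : omega m (L b') (L y) = 0.
  by rewrite (omega_dorbit_dorbit hact hexp hPhi) -pairing_coad gmu_b pairing0l.
have DL y : isotropy_gen act lexp m eta (L y) = L (lie_bracket (G := G) eta y).
  exact: isotropy_gen_dorbit.
have Dsym u v := omega_isotropy_genC hact hexp homega hpres stab_eta u v.
have D0 u v := omega_isotropy_gen0 hact hexp homega stab_eta (u := u) (v := v).
have xx : omega m (isotropy_gen act lexp m eta (L x)) (L x)
    = pairing (coad G x (coad G x mu)) eta.
  rewrite DL (omega_dorbit_dorbit hact hexp hPhi) !pairing_coad.
  by rewrite (lie_bracketC hexp x eta) lie_bracketNl (lie_bracketC hexp x) opprK.
have xb : omega m (isotropy_gen act lexp m eta (L b')) (L x) = 0.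
  rewrite (omega_isotropy_gen hact hexp homega hpres stab_eta) DL orth_b.
  exact: oppr0.
have bb : omega m (isotropy_gen act lexp m eta (L b')) (L b') = 0.
  rewrite (omega_isotropy_gen hact hexp homega hpres stab_eta) DL orth_b.
  exact: oppr0.
have xw : omega m (isotropy_gen act lexp m eta (L x)) w = 0.
  apply: D0 => t; rewrite isotropy_dorbit //.
  by apply: orth_s => //; apply: hs_inv => //; exact: stab_eta.
have ww : omega m (isotropy_gen act lexp m eta w) w = 0.
  by apply: D0 => t; apply: N0_isotropic => //; apply: hN0_inv => //; exact: stab_eta.
have wnu : omega m (isotropy_gen act lexp m eta w) nu = 0.
  apply: D0 => t; rewrite (symp_skew homega) orth_N1 ?oppr0 //.
  by apply: hN0_inv => //; exact: stab_eta.
have bw : omega m (isotropy_gen act lexp m eta (L b')) w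
    = pairing (- coad G b' (f w)) eta.
  rewrite pairingNl pairing_coad (lie_bracketC hexp eta b') pairingNr opprK.
  have scal := omega_scalarl homega m w.
  have adE : (fun t : R => omega m (isotropy act m (lexp (t *: eta)) (L b')) w) =
      pairing (f w) \o (fun t : R => Ad (lexp (t *: eta)) b').
    rewrite funeqE => t /=; have [fw _ _] := hf w N0w.
    rewrite isotropy_dorbit // fw ?xME //.
    by apply: mm_b; apply: hb_inv => //; exact: stab_eta.
  apply: etrans (esym (scalar_isotropy_gen hact hexp stab_eta (L b') scal)) _.
  apply: etrans (congr1 (fun c => derive1 c 0) adE) _.
  have [dAd _] := is_diff_Ad_lexp hexp eta b'.
  by rewrite (derive1_scalar_comp (pairing_scalar (f w)) dAd) (derive1_Ad_lexp hexp).
have xnu : omega m (isotropy_gen act lexp m eta (L x)) nu = 0 by rewrite DL.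
have bnu : omega m (isotropy_gen act lexp m eta (L b')) nu = 0 by rewrite DL.
rewrite /linear_momentum !xME.
have DD u v : isotropy_gen act lexp m eta (u + v)
    = isotropy_gen act lexp m eta u + isotropy_gen act lexp m eta v.
  by have := isotropy_gen_linear hact hexp stab_eta 1 u v; rewrite !scale1r.
pose B u v := omega m (isotropy_gen act lexp m eta u) v.
have BD u v z : B (u + v) z = B u z + B v z by rewrite /B DD (omegaDl homega).
have BE := biadditive_sqrD4 (L x) (L b') w nu BD Dsym.
apply: etrans (congr1 (fun r => 2%:R^-1 * r) BE) _.
have Bxx : B (L x) (L x) = _ := xx.
have Bbb : B (L b') (L b') = _ := bb.
have Bww : B w w = _ := ww.
have Bxb : B (L x) (L b') = _ := etrans (Dsym (L x) (L b')) xb.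
have Bxw : B (L x) w = _ := xw.
have Bxn : B (L x) nu = _ := xnu.
have Bbw : B (L b') w = _ := bw.
have Bbn : B (L b') nu = _ := bnu.
have Bwn : B w nu = _ := wnu.
rewrite -/(B nu nu); clearbody B.
rewrite Bxx Bbb Bww Bxb Bxw Bxn Bbw Bbn Bwn.
by field.
Qed.
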